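(* The edge variant of subgraph reconfiguration under each of the TJ and TS rules can be solved in linear time for the property ''a graph is a cycle.''
   Context: Graphs are finite, simple and undirected. In the edge variant for property $\Pi$ on a graph $G$, a feasible solution is an edge subset $E'\subseteq E(G)$ such that the graph formed by $E'$ (edge set $E'$ together with all endpoints of its edges) satisfies $\Pi$. Under the token jumping (TJ) rule, two feasible solutions $X,Y$ are adjacent if $|X\setminus Y|=|Y\setminus X|=1$; under the token sliding (TS) rule, they are adjacent if additionally the edge in $X\setminus Y$ and the edge in $Y\setminus X$ share an endpoint. A reconfiguration sequence is a sequence of feasible solutions in which consecutive ones are adjacent. The problem: given $G$ and feasible source and target solutions $E_s,E_t$, decide whether a reconfiguration sequence from $E_s$ to $E_t$ exists. *)

(* Defs.v *)
From mathcomp Require Import all_boot.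

Set Implicit Arguments.
Unset Strict Implicit.
Unset Printing Implicit Defensive.

(* The vertices of a graph need not exhaust the ambient type [T], so that
   subgraphs of a graph over [T] are again graphs over [T].  An edge is the
   two-element set of its endpoints. *)
Record sgraph (T : finType) := SGraph {
  vset : {set T};
  eset : {set {set T}};
  esetP : forall e, e \in eset -> #|e| = 2 /\ e \subset vset
}.

Definition graph_property := forall T : finType, sgraph T -> Prop.

Lemma formed_subproof (T : finType) (G : sgraph T) (X : {set {set T}}) :
  X \subset eset G -> forall e, e \in X -> #|e| = 2 /\ e \subset cover X.
Proof.
move=> /subsetP sXG e eX; split; last exact: bigcup_sup eX.
by case: (esetP (sXG _ eX)).
Qed.

Definition formed (T : finType) (G : sgraph T) (X : {set {set T}})
    (sXG : X \subset eset G) : sgraph T :=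
  SGraph (formed_subproof sXG).

Definition is_cycle : graph_property := fun T G =>
  exists c : seq T,
    [/\ 2 < size c, uniq c, vset G = [set x in c]
      & eset G = [set [set x; next c x] | x in c]].

Definition feasible (Pi : graph_property) (T : finType) (G : sgraph T)
    (X : {set {set T}}) : Prop :=
  exists sXG : X \subset eset G, Pi T (formed sXG).

Inductive rule := TJ | TS.

Definition adjacent (r : rule) (T : finType) : rel {set {set T}} := fun X Y =>
  [&& #|X :\: Y| == 1, #|Y :\: X| == 1
    & match r with
      | TJ => true
      | TS => [exists e in X :\: Y, exists f in Y :\: X, e :&: f != set0]
      end].

Definition reconfigurable (Pi : graph_property) (r : rule) (T : finType)
    (G : sgraph T) (Es Et : {set {set T}}) : Prop :=
  exists p : seq {set {set T}},
    [/\ forall X, X \in Es :: p -> feasible Pi G X,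
        path (@adjacent r T) Es p & last Es p = Et].

(* A program uses finitely many registers and a random-access memory.  Words
   are the natural numbers smaller than a bound [W]; producing a larger value
   is a fault, so a run that halts is also a run for every larger [W].  Every
   instruction costs one unit of time. *)
Inductive instr :=
  | Const of nat & nat
  | Add of nat & nat & nat
  | Sub of nat & nat & nat
  | Read of nat & nat
  | Write of nat & nat
  | Jz of nat & nat
  | Halt of bool.

Record state := State { pc : nat; reg : nat -> nat; mem : nat -> nat }.

Definition set_reg (W : nat) (st : state) (r v : nat) : option state :=
  if v < W then
    Some (State (pc st).+1 [eta reg st with r |-> v] (mem st))
  else None.

Definition step (W : nat) (st : state) (i : instr) : option state :=
  match i with
  | Const r k => set_reg W st r k
  | Add r s t => set_reg W st r (reg st s + reg st t)
  | Sub r s t => set_reg W st r (reg st s - reg st t)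
  | Read r s => set_reg W st r (mem st (reg st s))
  | Write r s =>
      Some (State (pc st).+1 (reg st) [eta mem st with reg st r |-> reg st s])
  | Jz r l =>
      Some (State (if reg st r == 0 then l else (pc st).+1) (reg st) (mem st))
  | Halt _ => None
  end.

(* [run W P t st = Some b] when [P], started in [st], halts with answer [b]
   after at most [t] instructions; faults and timeouts give [None]. *)
Fixpoint run (W : nat) (P : seq instr) (t : nat) (st : state) : option bool :=
  if t is t'.+1 then
    match onth P (pc st) with
    | Some (Halt b) => Some b
    | Some i => obind (run W P t') (step W st i)
    | None => None
    end
  else None.

Definition init (x : seq nat) : state := State 0 (fun=> 0) (nth 0 x).

(* Edges may be listed in any order and with either orientation. *)
Definition lists_edges (n : nat) (E : {set {set 'I_n}})
    (s : seq ('I_n * 'I_n)) : Prop :=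
  perm_eq [seq [set p.1; p.2] | p <- s] (enum E).

Definition edge_block (n : nat) (s : seq ('I_n * 'I_n)) : seq nat :=
  size s :: flatten [seq [:: val p.1; val p.2] | p <- s].

Definition encodes (n : nat) (G : sgraph 'I_n) (Es Et : {set {set 'I_n}})
    (x : seq nat) : Prop :=
  exists sG sS sT : seq ('I_n * 'I_n),
    [/\ lists_edges (eset G) sG, lists_edges Es sS, lists_edges Et sT
      & x = n :: edge_block sG ++ edge_block sS ++ edge_block sT].

(* One program handles all graphs, with time O(|V| + |E|) on words of
   O(log (|V| + |E|)) bits.  Only feasible source and target solutions are
   legal inputs. *)
Definition linear_time_solvable (Pi : graph_property) (r : rule) : Prop :=
  exists (P : seq instr) (c : nat),
    forall (n : nat) (G : sgraph 'I_n) (Es Et : {set {set 'I_n}}) (x : seq nat),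
      vset G = [set: 'I_n] ->
      feasible Pi G Es -> feasible Pi G Et ->
      encodes G Es Et x ->
      let N := #|vset G| + #|eset G| in
      exists2 b : bool,
        run (2 ^ (c * up_log 2 N.+2)) P (c * N.+1) (init x) = Some b
        & b <-> reconfigurable Pi r G Es Et.

(* Main.v *)
(* Two distinct cycles are never adjacent: removing an edge [e] from a cycle
   leaves exactly one edge at each endpoint of [e], and an edge [f <> e] misses
   one of these endpoints.  Hence the source reaches the target iff they are
   equal, and it remains to compare two edge lists, given in arbitrary order and
   orientation, in linear time.  The memory beyond the input is zero, so the
   adjacency matrix of the source can be stored there without being initialised:
   only the cells of source edges are written, and only the cells of target
   edges are read. *)
Require Import Defs.
From mathcomp Require Import all_boot.
From mathcomp Require Import zify.

Set Implicit Arguments.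
Unset Strict Implicit.
Unset Printing Implicit Defensive.

(** * Degrees in a cycle, and non-adjacency of cycles *)

(** Otherwise two steps forward from [v] would return to [v], whereas in a duplicate-free list of
    length at least 3, rotated to start at [v], they reach the third entry. *)
Lemma next_neq_prev (T : eqType) (c : seq T) (v : T) :
  2 < size c -> uniq c -> v \in c -> next c v != prev c v.
Proof.
move=> c2 Uc vc; apply/eqP => npv.
have : next c (next c v) = v by rewrite npv next_prev.
have [i s def_s] := rot_to vc.
rewrite -!(next_rot i Uc); move: c2; rewrite -(size_rot i).
have : uniq (rot i c) by rewrite rot_uniq.
rewrite def_s; case: s {def_s} => [|y [|z s]] //=.
rewrite !inE !negb_or -!andbA => /and4P[vy vz _ _] _.
by rewrite eqxx [y == v]eq_sym (negPf vy) eqxx => zv; rewrite zv eqxx in vz.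
Qed.

(** The edges at [v] are the one leading to its successor and the one coming from its predecessor;
    they differ because these two neighbours do. *)
Lemma is_cycle_degree (T : finType) (G : sgraph T) (v : T) :
  is_cycle G -> v \in vset G -> #|[set e in eset G | v \in e]| = 2.
Proof.
move=> [c [c2 Uc -> ->]]; rewrite inE => vc.
have -> : [set e in [set [set x; next c x] | x in c] | v \in e] =
          [set [set v; next c v]; [set prev c v; v]].
  apply/setP => e; rewrite !inE; apply/andP/orP.
    move=> [/imsetP[x xc ->]]; rewrite !inE => /orP[] /eqP ->; first by left.
    by right; rewrite prev_next.
  case=> /eqP ->; rewrite !inE eqxx ?orbT; split=> //; apply/imsetP.
    by exists v.
  by exists (prev c v); rewrite ?mem_prev // next_prev.
rewrite cards2; case: eqP => // /setP eq_e; case/eqP: (next_neq_prev c2 Uc vc).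
have := eq_e (next c v); have := eq_e (prev c v).
rewrite !inE !eqxx ?orbT /= => /orP[] /eqP; last by [].
move=> pv; rewrite pv; move/esym/orP => [] /eqP //.
Qed.

Lemma cycle_not_adjacent (r : rule) (T : finType) (G : sgraph T)
    (X Y : {set {set T}}) :
  feasible is_cycle G X -> feasible is_cycle G Y -> ~~ adjacent r X Y.
Proof.
move=> [sX cX] [sY cY]; apply/negP => /and3P[/cards1P[e De] /cards1P[f Df] _].
have [eX eY] : e \in X /\ e \notin Y.
  by have := set11 e; rewrite -De inE => /andP[].
have [fY fX] : f \in Y /\ f \notin X.
  by have := set11 f; rewrite -Df inE => /andP[].
have e2 := (esetP (subsetP sX e eX)).1; have f2 := (esetP (subsetP sY f fY)).1.
have /subsetPn[a ae af] : ~~ (e \subset f).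
  apply: contra fX => sef.
  by have /eqP <- : e == f by rewrite eqEcard sef e2 f2.
(* Since [f] misses [a], exchanging [e] for [f] only removes [e] from the edges at [a]. *)
have DX : [set g in X | a \in g] = e |: [set g in Y | a \in g].
  apply/setP => g; rewrite !inE; have [->|ge] := eqVneq g e; first by rewrite eX.
  have [ag|] := boolP (a \in g); rewrite ?andbF //= !andbT.
  have gf : g != f by apply: contraNneq af => <-.
  move/setP/(_ g): De; move/setP/(_ g): Df; rewrite !inE (negPf ge) (negPf gf).
  by case: (g \in X) (g \in Y) => [] [].
have dX : #|[set g in X | a \in g]| = 2.
  by apply: (is_cycle_degree cX); apply/bigcupP; exists e.
move: dX; rewrite DX cardsU1 inE (negPf eY) add1n => -[dY].
(* Exactly one edge of [Y] remains at [a]. It makes [a] a vertex of the cycle formed by [Y], where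
   the degree must be 2. *)
have /card_gt0P[g] : 0 < #|[set g in Y | a \in g]| by rewrite dY.
rewrite inE => /andP[gY ag].
have : #|[set g in Y | a \in g]| = 2.
  by apply: (is_cycle_degree cY); apply/bigcupP; exists g.
by rewrite dY.
Qed.

Lemma reconfigurable_cycleP (r : rule) (T : finType) (G : sgraph T)
    (Es Et : {set {set T}}) :
  feasible is_cycle G Es -> (Es = Et <-> reconfigurable is_cycle r G Es Et).
Proof.
move=> fS; split=> [<-|[[|X p] [fp]]]; last 2 first.
- by [].
- move=> /= /andP[adjX _] _.
  have fX : feasible is_cycle G X by apply: fp; rewrite in_cons mem_head orbT.
  by case/negP: (cycle_not_adjacent r fS fX).
by exists [::]; split=> // X; rewrite inE => /eqP ->.
Qed.

(** * Symbolic execution of the machine *)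

(** Registers kept as a list, with 0 past its end, let simplification compute their contents. *)
Definition state_of (pc : nat) (l : seq nat) (mm : nat -> nat) : state :=
  State pc (nth 0 l) mm.

(** Registers and memory are functions, and updating a list agrees with updating a function only
    pointwise. *)
Lemma run_ext (W : nat) (P : seq instr) (t : nat) (st st' : state) :
  pc st = pc st' -> reg st =1 reg st' -> Defs.mem st =1 Defs.mem st' ->
  run W P t st = run W P t st'.
Proof.
elim: t st st' => // t IHt [pc rg mm] [_ rg' mm'] /= <- rgE mmE.
have setE r v v' : v = v' ->
    obind (run W P t) (set_reg W (State pc rg mm) r v) =
    obind (run W P t) (set_reg W (State pc rg' mm') r v').
  move=> <-; rewrite /set_reg; case: ifP => //= _.
  by apply: IHt => //= k; rewrite /= rgE.
case: (onth P pc) => // -[r k|r a c|r a c|r a|a c|a k|k] //.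
- exact: setE.
- by apply: setE; rewrite /= !rgE.
- by apply: setE; rewrite /= !rgE.
- by apply: setE; rewrite /= rgE mmE.
- by apply: IHt => //= k; rewrite /= !rgE mmE.
- by apply: IHt => //=; rewrite rgE.
Qed.

Lemma run_mono (W : nat) (P : seq instr) (t t' : nat) (st : state) (b : bool) :
  t <= t' -> run W P t st = Some b -> run W P t' st = Some b.
Proof.
elim: t t' st => // t IHt [|t'] st //= le_t.
case: (onth P (pc st)) => // i.
by case: i => [r k|r a c|r a c|r a|a c|a k|k] //; case: step => //= st'; apply: IHt.
Qed.

Definition assigned (l : seq nat) (mm : nat -> nat) (i : instr) : option (nat * nat) :=
  match i with
  | Const r k => Some (r, k)
  | Add r s t => Some (r, nth 0 l s + nth 0 l t)
  | Defs.Sub r s t => Some (r, nth 0 l s - nth 0 l t)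
  | Read r s => Some (r, mm (nth 0 l s))
  | _ => None
  end.

Section Run.
Variables (W : nat) (P : seq instr) (t pc : nat) (l : seq nat) (mm : nat -> nat).
Variable b : bool.

(** The separate [v'] allows the computed value to be recorded in a more convenient form. *)
Lemma run_assign i r v v' :
  onth P pc = Some i -> assigned l mm i = Some (r, v) -> v = v' -> v' < W ->
  run W P t (state_of pc.+1 (set_nth 0 l r v') mm) = Some b ->
  run W P t.+1 (state_of pc l mm) = Some b.
Proof.
move=> /= -> iE <- {v'} vW runE.
suff : obind (run W P t) (set_reg W (state_of pc l mm) r v) = Some b.
  by case: i iE => //= [? ?|? ? ?|? ? ?|? ?] [<- <-].
rewrite /set_reg vW /= -runE; apply: run_ext => //= k /=.
by rewrite nth_set_nth.
Qed.

Lemma run_write r s :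
  onth P pc = Some (Write r s) ->
  run W P t (state_of pc.+1 l [eta mm with nth 0 l r |-> nth 0 l s]) = Some b ->
  run W P t.+1 (state_of pc l mm) = Some b.
Proof. by move=> /= ->. Qed.

Lemma run_jz r k :
  onth P pc = Some (Jz r k) ->
  run W P t (state_of (if nth 0 l r == 0 then k else pc.+1) l mm) = Some b ->
  run W P t.+1 (state_of pc l mm) = Some b.
Proof. by move=> /= ->. Qed.

Lemma run_halt :
  onth P pc = Some (Halt b) -> run W P t.+1 (state_of pc l mm) = Some b.
Proof. by move=> /= ->. Qed.

End Run.

(** * Memory segments and the comparison program *)

Definition stores (mm : nat -> nat) (a : nat) (s : seq nat) : Prop :=
  forall i, i < size s -> mm (a + i) = nth 0 s i.

Lemma stores_cat mm a s1 s2 :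
  stores mm a (s1 ++ s2) -> stores mm a s1 /\ stores mm (a + size s1) s2.
Proof.
move=> h; split=> i lt_i.
  by rewrite h ?size_cat ?nth_cat ?lt_i //; lia.
rewrite -addnA h ?size_cat ?ltn_add2l // nth_cat ifF; last by lia.
by congr nth; lia.
Qed.

Lemma stores_cons mm a k s :
  stores mm a (k :: s) -> mm a = k /\ stores mm a.+1 s.
Proof.
move=> /(@stores_cat _ _ [:: k])[h1 h2]; split; first by rewrite -[a]addn0 h1.
by rewrite -addn1.
Qed.

Lemma eq_stores mm mm' a s :
  (forall i, a <= i < a + size s -> mm i = mm' i) ->
  stores mm a s -> stores mm' a s.
Proof. by move=> mmE h i lt_i; rewrite -mmE ?h //; lia. Qed.

Definition flat (n : nat) (s : seq ('I_n * 'I_n)) : seq nat :=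
  flatten [seq [:: val p.1; val p.2] | p <- s].

Lemma size_flat n (s : seq ('I_n * 'I_n)) : size (flat s) = (size s).*2.
Proof. by elim: s => //= p s; rewrite /flat /= => ->. Qed.

Definition edge_of (n : nat) (p : 'I_n * 'I_n) : {set 'I_n} := [set p.1; p.2].

(* With [L] the length of the input, cell [L + u] receives the address
   [L + n + u * n] of row [u] of the matrix, as there is no multiplication.
   Register 0 is never written, so that [Jz 0 l] always jumps.  The loops over
   the rows, the source edges and the target edges start at 22, 28 and 43. *)
Definition comparison : seq instr :=
  [:: Const 1 1; Read 2 0; Read 3 1; Add 3 3 3; Add 3 3 1; Add 3 3 1;
      Read 4 3; Add 3 3 1; Add 5 3 4; Add 5 5 4; Read 6 5; Add 5 5 1;
      Add 7 5 6; Add 7 7 6; Defs.Sub 8 4 6; Defs.Sub 9 6 4; Add 8 8 9; Jz 8 19;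
      Halt false;
      Add 9 2 0; Add 10 7 0; Add 11 7 2;
      Jz 9 28; Write 10 11; Add 10 10 1; Add 11 11 2; Defs.Sub 9 9 1; Jz 0 22;
      Jz 4 43; Read 8 3; Add 3 3 1; Read 9 3; Add 3 3 1;
      Add 10 7 8; Read 10 10; Add 10 10 9; Write 10 1;
      Add 10 7 9; Read 10 10; Add 10 10 8; Write 10 1;
      Defs.Sub 4 4 1; Jz 0 28;
      Jz 6 55; Read 8 5; Add 5 5 1; Read 9 5; Add 5 5 1;
      Add 10 7 8; Read 10 10; Add 10 10 9; Read 10 10; Jz 10 56;
      Defs.Sub 6 6 1; Jz 0 43;
      Halt true; Halt false].

Local Arguments run : simpl never.

Ltac assign_to e :=
  eapply (@run_assign _ _ _ _ _ _ _ _ _ _ e); [reflexivity | reflexivity | | | ];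
  rewrite /=.
Ltac assign :=
  eapply run_assign; [reflexivity | reflexivity | reflexivity | | ];
  rewrite /=.

Ltac write := eapply run_write; [reflexivity | ]; rewrite /=.
Ltac jump := eapply run_jz; [reflexivity | ]; rewrite /=.

(** * The three loops, verified from the last to the first *)

Section Tables.
Variables (W n L : nat).
Hypothesis W_big : L + n + n * n + 1 < W.

Definition rows (mm : nat -> nat) (k : nat) : Prop :=
  forall u, u < k -> mm (L + u) = L + n + u * n.

Definition marks (mm : nat -> nat) (D : {set {set 'I_n}}) : Prop :=
  forall u v : 'I_n, mm (L + n + u * n + v) = ([set u; v] \in D).

(** Each edge costs at most 12 instructions, and the final jump and halt cost 2. Registers 1, 2 and
    7 hold the constants 1, [n] and [L]; register 5 points to the next target edge and register 6
    counts those left. *)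
Lemma run_check (s : seq ('I_n * 'I_n)) (D : {set {set 'I_n}}) mm a r3 r4 r8 r9 r10 r11 :
  rows mm n -> marks mm D -> stores mm a (flat s) -> a + (size s).*2 <= L ->
  run W comparison (12 * size s + 2)
    (state_of 43 [:: 0; 1; n; r3; r4; a; size s; L; r8; r9; r10; r11] mm) =
    Some (all (fun p => edge_of p \in D) s).
Proof.
move=> rowsP marksP; elim: s a r8 r9 r10 => [|[u v] s IHs] a r8 r9 r10.
  by move=> _ _; rewrite muln0; jump; apply: run_halt.
rewrite /flat /= => /stores_cons[a0 /stores_cons[a1 a2]] aL.
have un : u < n := ltn_ord u; have vn : v < n := ltn_ord v.
have ub : u * n + v < n * n by nia.
rewrite mulnS -addnA !addSn add0n.
jump.
assign_to (u : nat) => //; first by lia.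
assign; first by lia.
assign_to (v : nat); rewrite ?addn1 //; first by lia.
assign; first by lia.
assign; first by lia.
assign_to (L + n + u * n); [by rewrite rowsP | by lia |].
assign; first by lia.
assign_to ((edge_of (u, v) \in D) : nat); first by rewrite -marksP.
  by case: (_ \in D); lia.
jump; case: (_ \in D) => /=; last exact: run_halt.
assign; first by lia.
jump; rewrite subn1 addn1; apply: IHs => //; lia.
Qed.

(** An edge has two orientations, hence the two writes that mark it. *)
Lemma edge_of_eq (p q : 'I_n * 'I_n) :
  (edge_of p == edge_of q) = (p == q) || (p == (q.2, q.1)).
Proof.
case: p q => [u v] [u' v']; rewrite /edge_of /=; apply/eqP/orP.
  move=> E; have := set21 u v; have := set22 u v; rewrite {1 2}E.
  have := set21 u' v'; have := set22 u' v'; rewrite -{1 2}E.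
  do 4![case/set2P => ?]; subst; by [left; apply/eqP | right; apply/eqP].
by case=> /eqP[-> ->] //; rewrite setUC.
Qed.

(** Quotient and remainder modulo [n] recover the row and the column. *)
Lemma eq_cell (u v u' v' : 'I_n) :
  (L + n + u' * n + v' == L + n + u * n + v) = ((u', v') == (u, v)).
Proof.
apply/eqP/eqP => [|[-> ->]] // E; have n0 : 0 < n by case: u E => /=; lia.
have {}E : u' * n + v' = u * n + v by lia.
have := congr1 (divn^~ n) E; have := congr1 (modn^~ n) E.
rewrite !modnMDl !divnMDl // !modn_small // !divn_small // !addn0.
by move=> vE uE; congr pair; apply: val_inj.
Qed.

Lemma marks_write mm D (u v : 'I_n) : marks mm D ->
  marks [eta [eta mm with L + n + u * n + v |-> 1]
         with L + n + v * n + u |-> 1] (edge_of (u, v) |: D).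
Proof.
move=> marksP u' v'; rewrite /= !eq_cell in_setU1.
rewrite -[[set u'; v']]/(edge_of (u', v')) edge_of_eq /=.
by case: eqP => _; case: eqP => _ //=; rewrite marksP.
Qed.

(** [D] collects the edges marked so far, which makes the induction on the remaining source edges go
    through. Each costs 15 instructions. *)
Lemma run_mark (s s' : seq ('I_n * 'I_n)) D mm a b r8 r9 r10 r11 :
  rows mm n -> marks mm D ->
  stores mm a (flat s) -> a + (size s).*2 <= L ->
  stores mm b (flat s') -> b + (size s').*2 <= L ->
  run W comparison (15 * size s + (12 * size s' + 2).+1)
    (state_of 28 [:: 0; 1; n; a; size s; b; size s'; L; r8; r9; r10; r11] mm) =
    Some (all (fun p => (edge_of p \in map (@edge_of n) s) || (edge_of p \in D)) s').
Proof.
elim: s D mm a r8 r9 r10 => [|[u v] s IHs] D mm a r8 r9 r10 rowsP marksP.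
  by move=> _ _ ? ?; rewrite muln0 add0n; jump; apply: run_check.
rewrite /flat /= => /stores_cons[a0 /stores_cons[a1 a2]] aL bP bL.
have un : u < n := ltn_ord u; have vn : v < n := ltn_ord v.
have ub : u * n + v < n * n by nia.
have vb : v * n + u < n * n by nia.
rewrite mulnS -addnA !addSn add0n.
jump.
assign_to (u : nat) => //; first by lia.
assign; first by lia.
assign_to (v : nat); rewrite ?addn1 //; first by lia.
assign; first by lia.
assign; first by lia.
assign_to (L + n + u * n); [by rewrite rowsP | by lia |].
assign; first by lia.
write.
assign; first by lia.
assign_to (L + n + v * n); [by rewrite ifF ?rowsP //; lia | by lia |].
assign; first by lia.
write.
assign; first by lia.
jump; rewrite subn1 addn1 /=.
set mm' := (X in state_of _ _ X).
(* The matrix starts at [L + n], so marking leaves the input and the row addresses intact. *)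
have mmE i : i < L + n -> mm i = mm' i.
  by move=> lt_i; rewrite /mm' /= !ifF //; lia.
have rowsP' : rows mm' n by move=> w wn; rewrite -mmE ?rowsP //; lia.
have aP' : stores mm' a.+2 (flat s).
  by apply: eq_stores a2 => i; rewrite size_flat => ?; apply: mmE; lia.
have bP' : stores mm' b (flat s').
  by apply: eq_stores bP => i; rewrite size_flat => ?; apply: mmE; lia.
rewrite (IHs _ _ _ _ _ _ rowsP' (marks_write u v marksP) aP' _ bP' bL); last by lia.
by congr Some; apply: eq_all => p; rewrite in_setU1 inE orbCA orbA.
Qed.

(** Invariant: [j] row addresses are written and [k] remain, at 6 instructions each. *)
Lemma run_rows (s s' : seq ('I_n * 'I_n)) mm a b k j r8 :
  j + k = n -> rows mm j -> (forall i, L + n <= i -> mm i = 0) ->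
  stores mm a (flat s) -> a + (size s).*2 <= L ->
  stores mm b (flat s') -> b + (size s').*2 <= L ->
  run W comparison (6 * k + (15 * size s + (12 * size s' + 2).+1).+1)
    (state_of 22 [:: 0; 1; n; a; size s; b; size s'; L; r8; k; L + j;
       L + n + j * n] mm) =
    Some (all (fun p => edge_of p \in map (@edge_of n) s) s').
Proof.
elim: k j mm r8 => [|k IHk] j mm r8 jn rowsP mm0 aP aL bP bL.
  rewrite muln0 add0n; jump; rewrite addn0 in jn.
  have {}rowsP : rows mm n by move=> u un; apply: rowsP; rewrite jn.
  (* Zero memory already is the matrix of the empty edge set, so no quadratic clearing is needed. *)
  have marksP : marks mm set0 by move=> u v; rewrite inE mm0 //; lia.
  rewrite (@run_mark _ _ set0) //.
  by congr Some; apply: eq_all => p; rewrite in_set0 orbF.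
(* The last round computes the address just past the matrix, [L + n + n * n], which is still below
   [W]. *)
have jb : j.+1 * n <= n * n by rewrite leq_mul2r; lia.
rewrite mulnS -addnA !addSn add0n.
jump.
write.
assign; first by lia.
assign; first by lia.
assign; first by lia.
jump.
set mm' := (X in state_of _ _ X).
have mmE i : i != L + j -> mm i = mm' i by rewrite /mm' /= => /negPf ->.
rewrite subn1 /= (_ : L + j + 1 = L + j.+1); last by lia.
rewrite (_ : L + n + j * n + n = L + n + j.+1 * n); last by lia.
apply: IHk => //.
- by rewrite -jn addnS.
- move=> u; rewrite ltnS leq_eqVlt => /orP[/eqP -> | uj].
    by rewrite /mm' /= eqxx.
  by rewrite -mmE ?rowsP //; lia.
- by move=> i le_i; rewrite -mmE ?mm0 //; lia.
- by apply: eq_stores aP => i; rewrite size_flat => ?; apply: mmE; lia.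
- by apply: eq_stores bP => i; rewrite size_flat => ?; apply: mmE; lia.
Qed.

End Tables.

(** * The complete run on an encoded input *)

Lemma size_input (n : nat) (sG sS sT : seq ('I_n * 'I_n)) (x : seq nat) :
  x = n :: edge_block sG ++ edge_block sS ++ edge_block sT ->
  size x = (size sG).*2 + (size sS).*2 + (size sT).*2 + 4.
Proof.
have size_block (s : seq ('I_n * 'I_n)) : size (edge_block s) = (size s).*2.+1.
  by rewrite -size_flat.
by move=> ->; rewrite -cat1s !size_cat !size_block /=; lia.
Qed.

(** The 21 instructions before the loops are 18 that parse the header and compare the two lengths,
    and 3 that set up the first loop. *)
Lemma run_comparison (W n : nat) (sG sS sT : seq ('I_n * 'I_n)) (x : seq nat) :
  x = n :: edge_block sG ++ edge_block sS ++ edge_block sT ->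
  size x + n + n * n + 1 < W ->
  run W comparison (21 + (6 * n + (15 * size sS + (12 * size sT + 2).+1).+1))
    (init x) =
    Some ((size sS == size sT) &&
          all (fun p => edge_of p \in map (@edge_of n) sS) sT).
Proof.
move=> def_x W_big.
have size_x := size_input def_x.
have : stores (nth 0 x) 0 x by [].
rewrite {2}def_x.
move=> /stores_cons[x0 /stores_cat[/stores_cons[x1 _] /stores_cat[]]].
move=> /stores_cons[x2 xS] /stores_cons[x3 xT].
move: x2 xS x3 xT; rewrite /= -!/(flat _) !size_flat => x2 xS x3 xT.
(* The program uses registers 0 to 11 only, all initially 0. *)
rewrite (@run_ext _ _ _ _ (state_of 0 (nseq 12 0) (nth 0 x))) //; last first.
  by move=> k; rewrite -[RHS]/(nth 0 (nseq 12 0) k) nth_nseq if_same.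
set L := size x in W_big size_x *.
rewrite !addSn add0n.
assign; first by lia.
assign_to n => //; first by lia.
assign_to (size sG) => //; first by lia.
assign; first by lia.
assign; first by lia.
assign_to (1 + (size sG).*2.+1); [by lia | by lia | ].
assign_to (size sS) => //; first by lia.
assign_to (1 + (size sG).*2.+1).+1; [by lia | by lia | ].
assign; first by lia.
assign_to (1 + (size sG).*2.+1 + (size sS).*2.+1); [by lia | by lia | ].
assign_to (size sT) => //; first by lia.
assign_to (1 + (size sG).*2.+1 + (size sS).*2.+1).+1; [by lia | by lia | ].
assign; first by lia.
assign_to L; [by lia | by lia | ].
assign; first by lia.
assign; first by lia.
assign; first by lia.
jump.
(* The sum of the two truncated differences vanishes exactly when the lengths agree. *)
rewrite addn_eq0 !subn_eq0 -eqn_leq.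
case: eqP => [eq_sz|_]; last exact: run_halt.
assign_to n; [by lia | by lia | ].
assign_to (L + 0); [by [] | by lia | ].
assign_to (L + n + 0 * n); [by lia | by lia | ].
apply: run_rows => //; rewrite /L; try lia.
by move=> i le_i; rewrite nth_default //; lia.
Qed.

(** * Edge lists as edge sets, and the resource bounds *)

Lemma lists_edgesP (n : nat) (E : {set {set 'I_n}}) (s : seq ('I_n * 'I_n)) :
  lists_edges E s -> size s = #|E| /\ map (@edge_of n) s =i E.
Proof.
move=> sE; split; first by rewrite cardE -(perm_size sE) size_map.
by move=> e; rewrite (perm_mem sE) mem_enum.
Qed.

(** The lists are duplicate-free, so their lengths are cardinalities, and an inclusion between sets
    of equal cardinality is an equality. *)
Lemma all_edgesP (n : nat) (E F : {set {set 'I_n}}) (s t : seq ('I_n * 'I_n)) :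
  lists_edges E s -> lists_edges F t ->
  (size s == size t) && all (fun p => edge_of p \in map (@edge_of n) s) t =
  (E == F).
Proof.
move=> /lists_edgesP[sE memE] /lists_edgesP[sF memF].
rewrite [RHS]eq_sym eqEcard -sE -sF.
have -> : all (fun p => edge_of p \in map (@edge_of n) s) t = (F \subset E).
  rewrite -(all_map (@edge_of n) (mem (map (@edge_of n) s))).
  by apply/allP/subsetP => sub e; move: (sub e); rewrite memF inE memE.
have [sFE|] := boolP (F \subset E); last by rewrite andbF.
have le_ts : size t <= size s by rewrite sE sF subset_leq_card.
by rewrite andbT /= eqn_leq le_ts andbT.
Qed.

Theorem theorem3 (r : rule) : linear_time_solvable is_cycle r.
Proof.
(* The time is at most [25 + 6 * n + 27 * size sG], below [40 * N.+1]. The same 40 amply covers the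
   word size, for which the exponent 4 suffices. *)
exists comparison, 40 => n G Es Et x vG feasS feasT [sG [sS [sT [LG LS LT def_x]]]] N.
have [szG _] := lists_edgesP LG.
have [szS _] := lists_edgesP LS; have [szT _] := lists_edgesP LT.
(* Feasible solutions consist of edges of [G], so both lists are bounded by [size sG]. *)
have leS : size sS <= size sG.
  by rewrite szS szG subset_leq_card //; case: feasS.
have leT : size sT <= size sG.
  by rewrite szT szG subset_leq_card //; case: feasT.
have NE : N = n + size sG by rewrite /N vG cardsT card_ord szG.
exists (Es == Et).
  rewrite -(all_edgesP LS LT).
  apply: (@run_mono _ _ _ _ _ _ _ (run_comparison def_x _)); first by lia.
  have size_x := size_input def_x.
  have W4 : N.+2 ^ 4 <= 2 ^ (40 * up_log 2 N.+2).
    rewrite mulnC expnM (@leq_trans (N.+2 ^ 40)) ?leq_pexp2l //.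
    by rewrite leq_exp2r // up_logP.
  apply: leq_trans W4; rewrite size_x !expnS expn0; nia.
by rewrite -(reconfigurable_cycleP r Et feasS); split=> /eqP.
Qed.
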